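(* Let $(S,s)$ be an involutive solution of the PE. Then there exist elementary abelian $2$-groups $(A,+)$ and $(G,\cdot)$ and a non-empty set $X$ such that $S$ may be identified (via a bijection) with $X\times A\times G$ and then \[(S,s)=\operatorname{Ext}_X^\sigma(A,t_A)\times(G,s_G)\] for some map $\sigma\colon A\to\operatorname{Sym}(X)$. Moreover, $\operatorname{Ret}(S,s)=(A,t_A)$ (where the retract class of $(x,a,g)$ is identified with $a$), and $(S,s)$ is isomorphic to the product $(X,\mathrm{id})\times(A,t_A)\times(G,s_G)$ of solutions.
   Context: A (set-theoretic) solution of the Pentagon Equation (PE) is a pair $(S,s)$ where $S$ is a non-empty set and $s\colon S\times S\to S\times S$ satisfies $s_{23}s_{13}s_{12}=s_{12}s_{23}$ on $S^3$, where $s_{ij}$ acts as $s$ on the $i$-th and $j$-th components and as the identity on the remaining one. Write $s(x,y)=(x\cdot y,\theta_x(y))$; then $(S,\cdot)$ is a semigroup. The solution is involutive if $s^2=\mathrm{id}$. Two solutions $(S,s),(S',s')$ are isomorphic if there is a bijection $f\colon S\to S'$ with $(f\times f)s=s'(f\times f)$. The product $(S_1,s_1)\times(S_2,s_2)$ of solutions is the solution on $S_1\times S_2$ obtained by applying $s_1$ to the $S_1$-coordinates and $s_2$ to the $S_2$-coordinates. $(X,\mathrm{id})$ denotes the solution given by the identity map of $X\times X$. An elementary abelian $2$-group is an abelian group all of whose elements $g$ have trivial square (the trivial group is allowed). For an elementary abelian $2$-group $(A,+)$, $(A,t_A)$ is the solution $t_A(a,b)=(a,a+b)$. For an elementary abelian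 $2$-group $(G,\cdot)$, $(G,s_G)$ is the solution $s_G(g,h)=(gh,h)$. For a non-empty set $X$ and a map $\sigma\colon A\to\operatorname{Sym}(X)$, $a\mapsto\sigma_a$ (any map), $\operatorname{Ext}_X^\sigma(A,t_A)$ is the solution on $X\times A$ given by $((x,a),(y,b))\mapsto((x,a),(\sigma_{a+b}\sigma_b^{-1}(y),a+b))$. For an involutive solution $(S,s)$, the retract relation is $x\sim y\iff\theta_x=\theta_y$; the retract $\operatorname{Ret}(S,s)=(\overline S,\overline s)$ is the (well-defined) solution on $\overline S=S/{\sim}$ given by $\overline s(\overline x,\overline y)=(\overline x,\overline{\theta_x(y)})$, where $\overline{x}$ is the $\sim$-class of $x$. *)

(* Defs.v *)
From HB Require Import structures.
From mathcomp Require Import all_boot all_order all_algebra generic_quotient.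
From mathcomp Require Import boolp classical_sets functions.
Import GRing.Theory.

Set Implicit Arguments.
Unset Strict Implicit.
Unset Printing Implicit Defensive.

Definition act12 (S : Type) (s : S * S -> S * S) (p : S * S * S) : S * S * S :=
  let: (x, y, z) := p in let: (x', y') := s (x, y) in (x', y', z).

Definition act13 (S : Type) (s : S * S -> S * S) (p : S * S * S) : S * S * S :=
  let: (x, y, z) := p in let: (x', z') := s (x, z) in (x', y, z').

Definition act23 (S : Type) (s : S * S -> S * S) (p : S * S * S) : S * S * S :=
  let: (x, y, z) := p in let: (y', z') := s (y, z) in (x, y', z').

Definition pentagon (S : Type) (s : S * S -> S * S) : Prop :=
  forall p, act23 s (act13 s (act12 s p)) = act12 s (act23 s p).

Definition PE_solution (S : Type) (s : S * S -> S * S) : Prop :=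
  inhabited S /\ pentagon s.

Definition involutive_solution (S : Type) (s : S * S -> S * S) : Prop :=
  PE_solution s /\ involutive s.

(* s (x, y) = (x . y, theta s x y) *)
Definition theta (S : Type) (s : S * S -> S * S) (x y : S) : S := (s (x, y)).2.

Definition solution_iso (S S' : Type) (s : S * S -> S * S)
    (s' : S' * S' -> S' * S') (f : S -> S') : Prop :=
  bijective f /\
  forall x y, s' (f x, f y) = (f (s (x, y)).1, f (s (x, y)).2).

Definition isomorphic (S S' : Type) (s : S * S -> S * S)
    (s' : S' * S' -> S' * S') : Prop :=
  exists f : S -> S', solution_iso s s' f.

Definition prod_sol (S1 S2 : Type) (s1 : S1 * S1 -> S1 * S1)
    (s2 : S2 * S2 -> S2 * S2) (p : (S1 * S2) * (S1 * S2)) :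
    (S1 * S2) * (S1 * S2) :=
  let: ((x1, x2), (y1, y2)) := p in
  let: (u1, v1) := s1 (x1, y1) in
  let: (u2, v2) := s2 (x2, y2) in
  ((u1, u2), (v1, v2)).

Definition id_sol (X : Type) (p : X * X) : X * X := p.

Definition elementary_abelian2_add (A : zmodType) : Prop :=
  forall a : A, (a + a = 0)%R.

Definition elementary_abelian2_mul (G : groupType) : Prop :=
  (forall g h : G, (g * h = h * g)%g) /\ (forall g : G, (g * g = 1)%g).

Definition t_sol (A : zmodType) (p : A * A) : A * A :=
  let: (a, b) := p in (a, a + b)%R.

Definition s_sol (G : groupType) (p : G * G) : G * G :=
  let: (g, h) := p in (g * h, h)%g.

Definition Sym (X : Type) : Type := {splitbij [set: X] >-> [set: X]}.

Definition ext_sol (A : zmodType) (X : Type) (sigma : A -> Sym X)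
    (p : (X * A) * (X * A)) : (X * A) * (X * A) :=
  let: ((x, a), (y, b)) := p in
  ((x, a), (sigma (a + b)%R ((sigma b)^-1%FUN y), (a + b)%R)).

Local Open Scope quotient_scope.

Section Retract.
Variables (S : Type) (s : S * S -> S * S).

Definition ret_rel : rel {classic S} := fun x y => `[< theta s x = theta s y >].

Lemma ret_rel_refl : reflexive ret_rel.
Proof. by move=> x; apply/asboolP. Qed.

Lemma ret_rel_sym : symmetric ret_rel.
Proof. by move=> x y; apply/asboolP/asboolP => ->. Qed.

Lemma ret_rel_trans : transitive ret_rel.
Proof. by move=> y x z /asboolP xy /asboolP yz; apply/asboolP; rewrite xy. Qed.

Canonical ret_equiv := EquivRel ret_rel ret_rel_refl ret_rel_sym ret_rel_trans.

Definition ret_type : Type := {eq_quot ret_equiv}.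

Definition ret_class (x : S) : ret_type := \pi_({eq_quot ret_equiv}) x.

(* Representatives are used only to define the map: ret_solE shows that it does
   not depend on them when s is an involutive solution. *)
Definition ret_sol (p : ret_type * ret_type) : ret_type * ret_type :=
  let: (c, d) := p in
  (c, ret_class (theta s (repr (c : {eq_quot ret_equiv}))
                         (repr (d : {eq_quot ret_equiv})))).

Lemma ret_classP (x y : S) :
  ret_class x = ret_class y <-> theta s x = theta s y.
Proof.
split=> [/eqP|xy]; first by rewrite /ret_class eqmodE => /asboolP.
by apply/eqP; rewrite /ret_class eqmodE; apply/asboolP.
Qed.

Lemma ret_class_repr (c : ret_type) :
  ret_class (repr (c : {eq_quot ret_equiv})) = c.
Proof. exact: (@reprK _ {eq_quot ret_equiv}). Qed.

Lemma theta_theta (hs : involutive_solution s) (x y z : S) :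
  theta s (theta s x y) z = theta s y (theta s x z).
Proof.
case: hs => -[_ pe] inv.
have pe3 u v w : theta s (theta s u v) (theta s (s (u, v)).1 w) = theta s v w.
  have := congr1 snd (pe (u, v, w)); rewrite /theta /=.
  case: (s (u, v)) => a b /=.
  case: (s (a, w)) => c d /=; case: (s (b, d)) => e f /=.
  by case: (s (v, w)) => g h /=; case: (s (u, g)).
have := pe3 (s (x, y)).1 (s (x, y)).2 z.
have e : ((s (x, y)).1, (s (x, y)).2) = s (x, y) by case: (s _).
by rewrite /theta e inv /=.
Qed.

Lemma ret_solE (hs : involutive_solution s) (x y : S) :
  ret_sol (ret_class x, ret_class y) = (ret_class x, ret_class (theta s x y)).
Proof.
rewrite /ret_sol; congr pair; apply/ret_classP/funext => z.
have /ret_classP hx := ret_class_repr (ret_class x).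
have /ret_classP hy := ret_class_repr (ret_class y).
by rewrite !theta_theta // hx hy.
Qed.

End Retract.

(* Main.v *)
Require Import Defs.
From HB Require Import structures.
From mathcomp Require Import all_boot all_order all_algebra.
From mathcomp Require Import generic_quotient.
From mathcomp Require Import boolp classical_sets functions.

Set Implicit Arguments.
Unset Strict Implicit.
Unset Printing Implicit Defensive.

(** Involutivity reads [x . y . theta_x(y) = x] and
    [theta_(x . y) (theta_x(y)) = y].  The first identity produces idempotents,
    and an idempotent [e] yields the idempotent [f = theta_e(e)], for which
    [theta_f] is the identity.  It follows that every [theta_x] is an involution,
    that [theta_(x . y) = theta_x], and hence that each [theta_x] is a semigroup
    endomorphism.  Moreover [x . y . y = x], so [S] is the direct product of the
    left zero semigroup of its idempotents [x . x] and the Boolean group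
    [G = f . S].  The group [A] of all the [theta_x] acts freely on the
    idempotents, and [e |-> (theta_e(e), theta_e)] identifies them with
    [X * A], where [X] consists of the idempotents acting trivially.  In these
    coordinates every [sigma_a] is the identity. *)

(* [{classic T}] supplies the choice structure; every element is its own inverse. *)
Definition zmod2_of (T : Type) (add : T -> T -> T) (zero : T)
    (addA : associative add) (addC : commutative add)
    (add0 : left_id zero add) (add2 : left_inverse zero id add) : zmodType :=
  HB.pack {classic T} (GRing.isZmodule.Build {classic T} addA addC add0 add2).

Definition group2_of (T : Type) (mul : T -> T -> T) (one : T)
    (mulA : associative mul) (mul1l : left_id one mul)
    (mul1r : right_id one mul) (mulVl : left_inverse one id mul)
    (mulVr : right_inverse one id mul) : groupType :=
  HB.pack {classic T} (isGroup.Build {classic T} mulA mul1l mul1r mulVl mulVr).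

Definition dot (S : Type) (s : S * S -> S * S) (x y : S) : S := (s (x, y)).1.

Section InvolutivePentagon.
Variables (S : Type) (s : S * S -> S * S).
Hypothesis hs : involutive_solution s.

Local Notation th := (theta s).
Local Notation "x ** y" := (dot s x y) (at level 40, left associativity).

(** * Pentagon equation and involutivity in components *)

Lemma solE x y : s (x, y) = (x ** y, th x y).
Proof. by rewrite /dot /theta; case: (s _). Qed.

Lemma dotA x y z : x ** (y ** z) = x ** y ** z.
Proof.
have [[_ pe] _] := hs; have := pe (x, y, z).
rewrite /act23 /act13 /act12 /=; do !rewrite solE /=.
by case.
Qed.

Lemma th_dot_twist x y z : th x (y ** z) = th x y ** th (x ** y) z.
Proof.
have [[_ pe] _] := hs; have := pe (x, y, z).
rewrite /act23 /act13 /act12 /=; do !rewrite solE /=.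
by case.
Qed.

Lemma th_th x y z : th (th x y) z = th y (th x z).
Proof. exact: theta_theta. Qed.

Lemma th_pentagon x y z : th y (th x (th (x ** y) z)) = th y z.
Proof.
have [[_ pe] _] := hs; have := pe (x, y, z).
rewrite /act23 /act13 /act12 /=; do !rewrite solE /=.
by case=> _ _; rewrite th_th.
Qed.

Lemma dot_dot_th x y : x ** y ** th x y = x.
Proof. by have [_ /(_ (x, y))] := hs; rewrite !solE => -[]. Qed.

Lemma th_dot_th x y : th (x ** y) (th x y) = y.
Proof. by have [_ /(_ (x, y))] := hs; rewrite !solE => -[]. Qed.

Lemma th_swap x y : th x (y ** th x y) = th x y ** y.
Proof. by rewrite th_dot_twist th_dot_th. Qed.

(** * Idempotents acting as the identity *)

Lemma dot_th_dot x : x ** th x x ** x = x.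
Proof.
have := dot_dot_th x (x ** th x x).
by rewrite th_swap !dotA dot_dot_th.
Qed.

(** Since [th f] is idempotent and commutes with left multiplication by [f], the left sides of
    [th_dot_th] at [th f y] and at [y] coincide, while the right sides are [th f y] and [y]. *)
Lemma idempotent_th_id f : f ** f = f -> th f f = f -> th f =1 id.
Proof.
move=> ff tf y.
have pp : th f (th f y) = th f y by rewrite -th_th tf.
have fp : f ** th f y = th f (f ** y) by rewrite th_dot_twist tf ff.
have := th_dot_th f (th f y); rewrite pp => <-.
by rewrite fp th_th pp th_dot_th.
Qed.

Lemma ex_idempotent_th_id : exists f, f ** f = f /\ th f =1 id.
Proof.
have [[[x] _] _] := hs.
(* [e] is idempotent because [x . th x x . x = x]; [th e] exchanges [e] and [f], so
   [th f f = th e (th e f) = f]. *)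
pose e := x ** th x x; pose f := th e e.
have ee : e ** e = e by rewrite /e dotA dot_th_dot.
have ef : th e f = e by have := th_dot_th e e; rewrite ee.
have ff : f ** f = f by have := th_dot_twist e e e; rewrite !ee.
by exists f; split=> //; apply: idempotent_th_id; rewrite // th_th ef.
Qed.

(** * The maps [th x] as commuting involutive endomorphisms *)

(** The pentagon identity makes [th a] a left inverse of [th (a . f)]. At [a = x . f] this says that
    [th (x . f)] is an involution; at [a = x] it then gives the equality. *)
Lemma th_dotr f x y : f ** f = f -> th f =1 id -> th (x ** f) y = th x y.
Proof.
move=> ff tf.
have cancel_f a w : th a (th (a ** f) w) = w.
  by have := th_pentagon a f w; rewrite !tf.
have xfxf w : th (x ** f) (th (x ** f) w) = w.
  by have := cancel_f (x ** f) w; rewrite -dotA ff.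
by rewrite -{2}(xfxf y) cancel_f.
Qed.

Lemma thK x : involutive (th x).
Proof.
move=> y; have [f [ff tf]] := ex_idempotent_th_id.
by have := th_pentagon x f y; rewrite !tf th_dotr.
Qed.

Lemma th_dot x y z : th (x ** y) z = th x z.
Proof.
have := th_pentagon x y z.
by move/(congr1 (th y)); rewrite !thK => /(congr1 (th x)); rewrite thK.
Qed.

(** The composite of the involutions [th x] and [th y] is [th (th y x)], again an involution, so
    they commute. *)
Lemma thC x y z : th x (th y z) = th y (th x z).
Proof. have := thK (th y x) z; rewrite !th_th.
by move/(congr1 (th x)); rewrite thK => /(congr1 (th y)); rewrite thK. Qed.

Lemma th_morph x y z : th x (y ** z) = th x y ** th x z.
Proof. by rewrite th_dot_twist th_dot. Qed.

(** * Right multiplications *)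

Lemma dotKK x y : x ** y ** y = x.
Proof.
(* [u] fixes [x] from the right and acts as the identity, so involutivity at [(u, y)] reads
   [u . y . y = u]. *)
pose u := th x x ** x.
have xu : x ** u = x by rewrite dotA dot_th_dot.
have tu z : th u z = z by rewrite th_dot th_th thK.
by have := dot_dot_th u y; rewrite tu => uyy; rewrite -{1}xu -2!(dotA x) uyy.
Qed.

Lemma dot_injr z x y : x ** z = y ** z -> x = y.
Proof. by move=> xyz; rewrite -(dotKK x z) xyz dotKK. Qed.

(** Right multiplications are involutions closed under composition, hence they commute. *)
Lemma dotAC x y z : x ** y ** z = x ** z ** y.
Proof.
have := dotKK x (y ** z); rewrite !dotA => /(congr1 (fun w => w ** z ** y)).
by rewrite !dotKK.
Qed.

Lemma dot_idempotent e x : e ** e = e -> x ** e = x.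
Proof. by move=> ee; rewrite -{1}(dotKK x e) -dotA ee dotKK. Qed.

Lemma idempotent_square x : x ** x ** (x ** x) = x ** x.
Proof. by rewrite dotA dotKK. Qed.

(** Both [th x y] and [y] send [x . y] back to [x]; right cancellation transfers this to any [f]. *)
Lemma dot_th_r f x y : f ** th x y = f ** y.
Proof.
have := congr1 (dot s f) (etrans (dot_dot_th x y) (esym (dotKK x y))).
rewrite !dotA (dotAC _ _ (th x y)) (dotAC _ x (th x y)).
by move/dot_injr; rewrite [RHS]dotAC => /dot_injr.
Qed.

(** * The group structure on the retract *)

Local Notation ret := (ret_type s).
Local Notation cl := (ret_class s).

Definition ret_add (a b : ret) : ret := (ret_sol (a, b)).2.

Lemma ret_ind (P : ret -> Prop) : (forall x, P (cl x)) -> forall a, P a.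
Proof. by move=> Pcl a; rewrite -(ret_class_repr a). Qed.

Lemma ret_addE x y : ret_add (cl x) (cl y) = cl (th x y).
Proof. by rewrite /ret_add ret_solE. Qed.

Lemma ret_eq x y : th x =1 th y -> cl x = cl y.
Proof. by move=> xy; apply/ret_classP/funext. Qed.

Lemma ret_addA : associative ret_add.
Proof.
elim/ret_ind=> x; elim/ret_ind=> y; elim/ret_ind=> z.
by rewrite !ret_addE; apply: ret_eq => w; rewrite !th_th.
Qed.

Lemma ret_addC : commutative ret_add.
Proof.
elim/ret_ind=> x; elim/ret_ind=> y.
by rewrite !ret_addE; apply: ret_eq => w; rewrite !th_th thC.
Qed.

Local Open Scope quotient_scope.

Section Decomposition.
Variable f : S.
Hypotheses (ff : f ** f = f) (tf : th f =1 id).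

Lemma ret_add0 : left_id (cl f) ret_add.
Proof. by elim/ret_ind=> x; rewrite ret_addE tf. Qed.

Lemma ret_addN : left_inverse (cl f) id ret_add.
Proof.
elim/ret_ind=> x; rewrite ret_addE; apply: ret_eq => y.
by rewrite th_th thK tf.
Qed.

Definition retA : zmodType := zmod2_of ret_addA ret_addC ret_add0 ret_addN.

(** As [f] is idempotent, the condition cuts out [f . S]. *)
Definition boolean_part : Type := {g : S | f ** g = g}.

Lemma boolean_part_inj (g h : boolean_part) : sval g = sval h -> g = h.
Proof. by case: g h => [g fg] [h fh]; apply: eq_exist. Qed.

Definition boolean_proj (x : S) : boolean_part :=
  exist _ (f ** x) (etrans (dotA f f x) (congr1 (dot s ^~ x) ff)).

Definition boolean_mul (g h : boolean_part) := boolean_proj (sval g ** sval h).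

Lemma boolean_projK (g : boolean_part) : boolean_proj (sval g) = g.
Proof. by apply: boolean_part_inj => /=; rewrite (svalP g). Qed.

Lemma boolean_projM x y :
  boolean_proj (x ** y) = boolean_mul (boolean_proj x) (boolean_proj y).
Proof.
apply: boolean_part_inj => /=.
by rewrite !dotA ff (dot_idempotent _ ff).
Qed.

Lemma boolean_mulA : associative boolean_mul.
Proof.
move=> g h k; rewrite -[g]boolean_projK -[h]boolean_projK -[k]boolean_projK.
by rewrite -!boolean_projM dotA.
Qed.

Lemma boolean_mulC : commutative boolean_mul.
Proof.
by move=> g h; apply: boolean_part_inj => /=; rewrite !dotA dotAC.
Qed.

Lemma boolean_mul1g : left_id (boolean_proj f) boolean_mul.
Proof.
move=> g; rewrite -[g]boolean_projK -boolean_projM.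
by rewrite (svalP g).
Qed.

Lemma boolean_mulg1 : right_id (boolean_proj f) boolean_mul.
Proof. by move=> g; rewrite boolean_mulC boolean_mul1g. Qed.

Lemma boolean_mulgg : left_inverse (boolean_proj f) id boolean_mul.
Proof.
by move=> g; apply: boolean_part_inj => /=; rewrite dotA dotKK ff.
Qed.

Definition boolG : groupType :=
  group2_of boolean_mulA boolean_mul1g boolean_mulg1 boolean_mulgg boolean_mulgg.

(** * Coordinates on [S] *)

Definition fixed_part : Type := {e : S | e ** e = e /\ th e =1 id}.

(** [x . x] acts as [x] does, so its image under [th x] acts as the square of [th x], the
    identity. *)
Lemma fixed_projP x : let e := th x (x ** x) in e ** e = e /\ th e =1 id.
Proof.
split=> [|y]; first by rewrite -th_morph idempotent_square.
by rewrite th_th th_dot thK.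
Qed.

Definition fixed_proj (x : S) : fixed_part := exist _ _ (fixed_projP x).

Lemma fixed_proj_eq x y :
  th x (x ** x) = th y (y ** y) -> fixed_proj x = fixed_proj y.
Proof. exact: eq_exist. Qed.

Definition coords (x : S) : fixed_part * retA * boolG :=
  (fixed_proj x, cl x, boolean_proj x).

(** Rebuilds [x] as [x . x . (f . x)], where [th x] recovers [x . x] from [th x (x . x)]; any
    representative of the class gives the same map. *)
Definition of_coords (p : fixed_part * retA * boolG) : S :=
  th (repr (p.1.2 : {eq_quot ret_equiv s})) (sval p.1.1)
    ** sval (p.2 : boolean_part).

Lemma coordsK : cancel coords of_coords.
Proof.
move=> x; rewrite /of_coords /=.
have /ret_classP-> := ret_class_repr (cl x).
by rewrite thK dotA (dot_idempotent _ ff) dotKK.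
Qed.

Lemma of_coordsK : cancel of_coords coords.
Proof.
move=> [[[e [ee te]] a] [g fg]]; rewrite /of_coords /=.
set c := repr _; set y := th c e ** g.
have ty : th y =1 th c by move=> z; rewrite th_dot th_th te.
congr (_, _, _).
(* The two factors [g] cancel in [y . y], leaving the idempotent [th c e], which [th c] returns to
   [e]. *)
- apply: eq_exist; rewrite ty /y !dotA dotAC dotKK.
  by rewrite -th_morph ee thK.
- by rewrite -[RHS](ret_class_repr a); apply: ret_eq.
- by apply: boolean_part_inj; rewrite /= dotA dot_th_r (dot_idempotent _ ee).
Qed.

Lemma coords_bij : bijective coords.
Proof. by exists of_coords; [exact: coordsK | exact: of_coordsK]. Qed.

(** * The solution in coordinates *)

Lemma fixed_proj_dot x y : fixed_proj (x ** y) = fixed_proj x.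
Proof. by apply: fixed_proj_eq; rewrite th_dot !dotA dotAC dotKK. Qed.

Lemma fixed_proj_th x y : fixed_proj (th x y) = fixed_proj y.
Proof. by apply: fixed_proj_eq; rewrite th_th -!th_morph thK. Qed.

Lemma cl_dot x y : cl (x ** y) = cl x.
Proof. by apply: ret_eq => z; rewrite th_dot. Qed.

Lemma boolean_proj_th x y : boolean_proj (th x y) = boolean_proj y.
Proof. by apply: boolean_part_inj; rewrite /= dot_th_r. Qed.

Lemma coords_dot x y :
  coords (x ** y)
  = (fixed_proj x, cl x, boolean_mul (boolean_proj x) (boolean_proj y)).
Proof. by rewrite /coords fixed_proj_dot cl_dot boolean_projM. Qed.

Lemma coords_th x y :
  coords (th x y) = (fixed_proj y, ret_add (cl x) (cl y), boolean_proj y).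
Proof. by rewrite /coords fixed_proj_th boolean_proj_th ret_addE. Qed.

End Decomposition.
End InvolutivePentagon.

Theorem theorem5p5 (S : Type) (s : S * S -> S * S)
    (hs : involutive_solution s) :
  exists (A : zmodType) (G : groupType) (X : Type),
    [/\ elementary_abelian2_add A, elementary_abelian2_mul G & inhabited X] /\
    (exists (f : S -> X * A * G) (sigma : A -> Sym X),
       solution_iso s (prod_sol (ext_sol sigma) (@s_sol G)) f /\
       exists r : ret_type s -> A,
         solution_iso (@ret_sol S s) (@t_sol A) r /\
         forall x : S, r (ret_class s x) = (f x).1.2) /\
    isomorphic s
      (prod_sol (prod_sol (@id_sol X) (@t_sol A)) (@s_sol G)).
Proof.
have [f [ff tf]] := ex_idempotent_th_id hs.
exists (retA hs tf), (boolG hs ff), (fixed_part s); split; last split.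
- split=> [a||]; first exact: ret_addN.
  + by split=> [g h|g]; [exact: boolean_mulC | exact: boolean_mulgg].
  + by exists; exact: fixed_proj hs f.
- exists (coords hs ff tf), (fun=> idfun); split.
    split=> [|x y]; first exact: coords_bij.
    by rewrite -[(s _).1]/(dot s x y) -[(s _).2]/(theta s x y)
       coords_dot coords_th.
  (* [retA] lives on the retract itself with addition read off [ret_sol], so the identity is the
     required isomorphism. *)
  exists id; split=> //; split; first by exists id.
  by case.
- exists (coords hs ff tf); split=> [|x y]; first exact: coords_bij.
  by rewrite -[(s _).1]/(dot s x y) -[(s _).2]/(theta s x y)
       coords_dot coords_th.
Qed.
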